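(* Let $(X,d)$ be a compact metric space and let $\phi$ be a continuous flow on $X$ without singularities. If there exists a point $p\in\Omega(\phi)\setminus Per(\phi)$ which is shadowable and uniformly-expansive, then the topological entropy satisfies $h(\phi)>0$.
   Context: A continuous flow on $X$ is a continuous map $\phi:\mathbb{R}\times X\to X$, $\phi^t(x)=\phi(t,x)$, with $\phi^0=\mathrm{id}$ and $\phi^{t+s}=\phi^s\circ\phi^t$; $O(x)=\{\phi^t(x):t\in\mathbb{R}\}$. A point $x$ is periodic if there is $T>0$ with $\phi^{t+T}(x)=\phi^t(x)$ for all $t$; its period $\pi(x)$ is the infimum of such $T\ge0$, and $x$ is a singularity if $\pi(x)=0$. $Per(\phi)$ is the set of periodic points. $x$ is wandering if there are a neighborhood $U$ of $x$ and $T>0$ with $\phi^t(x)\notin U$ for all $t\ge T$; $\Omega(\phi)$ is the set of non-wandering points. A reparametrization is an increasing homeomorphism $h:\mathbb{R}\to\mathbb{R}$ with $h(0)=0$; $Rep(\phi)$ is the set of them. A sequence $(x_i,t_i)_{i=a}^b$ is a $(\delta,T)$-pseudo-orbit if $t_i\ge T$ and $d(\phi^{t_i}(x_i),x_{i+1})<\delta$ for all $i$. Put $s_i=\sum_{n=0}^{i-1}t_n$ for $i\ge0$, $s_i=-\sum_{n=i}^{-1}t_n$ for $i<0$. It is $\varepsilon$-shadowed if there are $x\in X$ and $h\in Rep(\phi)$ with $d(\phi^{h(t)}(x),\phi^{t-s_i}(x_i))<\varepsilon$ for all $i$ and $s_i\le t\le s_{i+1}$. A point $p$ is shadowable if for every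 $\varepsilon>0$ there is $\delta>0$ such that every $(\delta,1)$-pseudo-orbit $(x_i,t_i)$ with $x_0=p$ is $\varepsilon$-shadowed. A point $p$ is uniformly-expansive if there is a neighborhood $U$ of $p$ such that for every $\varepsilon>0$ there is $\delta>0$ such that whenever $y,z\in U$ and some reparametrization $h$ satisfies $d(\phi^t(y),\phi^{h(t)}(z))<\delta$ for all $t\in\mathbb{R}$, then $y=\phi^t(w)$ with $w\in O(z)$ and $|t|<\varepsilon$. Topological entropy: a set $E$ is $(t,\varepsilon)$-separated if for distinct $x,y\in E$ there is $0\le u\le t$ with $d(\phi^u(x),\phi^u(y))\ge\varepsilon$; with $s_t(X,\varepsilon)$ the maximal cardinality of such sets, $h(\phi)=\lim_{\varepsilon\to0}\limsup_{t\to\infty}\frac1t\log s_t(X,\varepsilon)$. *)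

(* Defs.v *)
From HB Require Import structures.
From mathcomp Require Import all_boot all_order all_algebra.
From mathcomp Require Import all_classical all_reals all_analysis.
Set Implicit Arguments. Unset Strict Implicit. Unset Printing Implicit Defensive.
Import Order.TTheory GRing.Theory Num.Theory.
Import numFieldNormedType.Exports.
Local Open Scope classical_set_scope.
Local Open Scope ring_scope.

Section FlowDefs.
Context {R : realType} {X : metricType R}.
Implicit Types (phi : R -> X -> X) (x y z : X).

Local Notation d := (@mdist R X).

Definition is_flow phi :=
  [/\ continuous (fun q : R * X => phi q.1 q.2),
      (forall x, phi 0 x = x) &
      (forall t s x, phi (t + s) x = phi s (phi t x))].

Definition orbit phi x : set X := [set phi t x | t in [set: R]].

Definition periodic phi x :=
  exists T : R, 0 < T /\ forall t, phi (t + T) x = phi t x.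

Definition Per phi : set X := [set x | periodic phi x].

Definition period phi x : R :=
  inf [set T : R | 0 < T /\ forall t, phi (t + T) x = phi t x].

Definition singularity phi x := periodic phi x /\ period phi x = 0.

Definition wandering phi x :=
  exists U : set X, nbhs x U /\ exists T : R, 0 < T /\
    forall t, T <= t -> phi t @` U `&` U = set0.

Definition Omega phi : set X := [set x | ~ wandering phi x].

Definition Rep (h : R -> R) :=
  [/\ h 0 = 0, (forall a b : R, a < b -> h a < h b), continuous h &
      exists g : R -> R, [/\ cancel h g, cancel g h & continuous g]].

(* A pseudo-orbit (x_i, t_i)_{i=a}^b with a in Z u {-oo} (None = -oo) and
   b in Z u {+oo} (None = +oo). *)
Definition in_range (a b : option int) (i : int) : Prop :=
  (if a is Some a' then a' <= i else True) /\
  (if b is Some b' then i <= b' else True).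

Definition pseudo_orbit phi (delta T : R) (a b : option int)
    (xs : int -> X) (ts : int -> R) :=
  (forall i, in_range a b i -> T <= ts i) /\
  (forall i, in_range a b i -> in_range a b (i + 1) ->
     d (phi (ts i) (xs i)) (xs (i + 1)) < delta).

Definition sseq (ts : int -> R) (i : int) : R :=
  match i with
  | Posz n => \sum_(k < n) ts (Posz k)
  | Negz n => - \sum_(k < n.+1) ts (- (Posz k.+1))
  end.

Definition eps_shadowed phi (eps : R) (a b : option int)
    (xs : int -> X) (ts : int -> R) :=
  exists (x : X) (h : R -> R), Rep h /\
    forall i, in_range a b i -> forall t,
      sseq ts i <= t <= sseq ts (i + 1) ->
      d (phi (h t) x) (phi (t - sseq ts i) (xs i)) < eps.

Definition shadowable phi (p : X) :=
  forall eps : R, 0 < eps -> exists delta : R, 0 < delta /\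
    forall a b xs ts, in_range a b 0 -> xs 0 = p ->
      pseudo_orbit phi delta 1 a b xs ts -> eps_shadowed phi eps a b xs ts.

Definition uniformly_expansive phi (p : X) :=
  exists U : set X, nbhs p U /\
    forall eps : R, 0 < eps -> exists delta : R, 0 < delta /\
      forall y z (h : R -> R), U y -> U z -> Rep h ->
        (forall t, d (phi t y) (phi (h t) z) < delta) ->
        exists w t, orbit phi z w /\ `|t| < eps /\ y = phi t w.

Definition separated phi (t eps : R) (E : seq X) :=
  uniq E /\ forall x y, x \in E -> y \in E -> x != y ->
    exists u : R, 0 <= u <= t /\ eps <= d (phi u x) (phi u y).

Definition s_sep phi (t eps : R) : \bar R :=
  ereal_sup [set ((size E)%:R)%:E | E in [set E | separated phi t eps E]].

Definition sep_rate phi (eps t : R) : \bar R :=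
  match s_sep phi t eps with
  | EFin r => (ln r / t)%:E
  | +oo%E => +oo%E
  | -oo%E => -oo%E
  end.

Definition top_entropy phi : \bar R :=
  lim ((fun eps : R => limf_esup (sep_rate phi eps) (pinfty_nbhs R)) @ 0^'+).

End FlowDefs.

(* Main.v *)
Require Import Defs.
From HB Require Import structures.
From mathcomp Require Import all_boot all_order all_algebra.
From mathcomp Require Import all_classical all_reals all_analysis.
From mathcomp Require Import zify lra.
Import Order.TTheory GRing.Theory Num.Theory.
Import numFieldNormedType.Exports.
Local Open Scope classical_set_scope.
Local Open Scope ring_scope.

(* Shadowing the periodic pseudo-orbits that a nonwandering point p produces
   gives orbits all of whose limit points are again shadows of the same
   pseudo-orbit, hence lie on the same orbit by expansivity; such an orbit is
   compact, hence periodic by Baire's argument. So p is a limit of periodic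
   points, and being nonperiodic it is close to two distinct periodic orbits A
   and B. Pseudo-orbits that turn around A and B alternately, each for a short
   or a long time, encode words of bits. By expansivity and compactness an orbit
   near A and an orbit near B cannot fellow travel for a long time, even up to
   reparametrization. Two shadows that are not separated therefore switch
   between A and B at nearly the same times, so they encode the same word: this
   gives 2^n separated orbits in a time proportional to n. *)

(** * Reparametrizations of the line and ultrafilter limits *)

Section Reparametrizations.
Set Implicit Arguments.
Unset Strict Implicit.
Context {R : realType}.
Implicit Types (f g h : R -> R) (a b c t u C : R).

(** Limits along one ultrafilter replace repeated extraction of subsequences. A cluster point of the
    image filter is a limit because an ultrafilter contains each set or its complement. *)
Lemma ultra_cvg_compact {I : Type} {T : topologicalType} (F : set_system I)
    (K : set T) (f : I -> T) :
  UltraFilter F -> compact K -> (\forall i \near F, K (f i)) ->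
  exists2 l, K l & f i @[i --> F] --> l.
Proof.
move=> FU cK FK.
have FP : ProperFilter (f @ F) by apply: fmap_proper_filter.
have [l [Kl lF]] := cK (f @ F) FP FK.
exists l => // A Al.
have [//|FA] := in_ultra_setVsetC (f @^-1` A) FU.
have FA' : (f @ F) (~` A) by [].
by have [x []] := lF _ _ FA' Al.
Qed.

Lemma lipschitz_continuous_real f C :
  (forall s t, s <= t -> `|f t - f s| <= C * (t - s)) -> continuous f.
Proof.
move=> fC x; apply/cvgrPdist_lt => e e0.
have C1 : 0 < `|C| + 1 by rewrite ltr_pwDr.
exists (e / (`|C| + 1)); first exact: divr_gt0.
move=> y /= xy.
have H : `|f x - f y| <= `|C| * `|x - y|.
  have [le|/ltW le] := leP x y.
    rewrite distrC [X in _ <= _ * X]distrC [X in _ <= _ * X]ger0_norm ?subr_ge0//.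
    by apply: le_trans (fC _ _ le) _; rewrite ler_wpM2r ?subr_ge0 ?ler_norm.
  rewrite [X in _ <= _ * X]ger0_norm ?subr_ge0//.
  by apply: le_trans (fC _ _ le) _; rewrite ler_wpM2r ?subr_ge0 ?ler_norm.
apply: le_lt_trans H _; rewrite ltr_pdivlMr// in xy.
by apply: le_lt_trans xy; rewrite mulrC ler_wpM2l// lerDl.
Qed.

Lemma Rep_le {h} : Rep h -> forall a b, a <= b -> h a <= h b.
Proof.
case=> _ hi _ _ a b; rewrite le_eqVlt => /predU1P[->//|/hi/ltW//].
Qed.

Lemma Rep_inverse {h} : Rep h -> exists g, [/\ Rep g, cancel h g & cancel g h].
Proof.
move=> Rh; have [h0 hi hc [g [hg gh gc]]] := Rh.
exists g; split => //; split => //.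
- by rewrite -{1}h0 hg.
- move=> a b ab; rewrite ltNge; apply/negP => /(Rep_le Rh).
  by rewrite !gh leNgt ab.
- by exists h.
Qed.

Lemma Rep_comp {g h} : Rep g -> Rep h -> Rep (g \o h).
Proof.
move=> [g0 gi gc [g' [gK g'K g'c]]] [h0 hi hc [h' [hK h'K h'c]]]; split.
- by rewrite /= h0.
- by move=> a b ab; apply/gi/hi.
- by move=> x; apply: continuous_comp; [exact: hc|exact: gc].
- exists (h' \o g'); split.
  + by move=> x; rewrite /= gK hK.
  + by move=> x; rewrite /= h'K g'K.
  + by move=> x; apply: continuous_comp; [exact: g'c|exact: h'c].
Qed.

Lemma Rep_shift {h} c : Rep h -> Rep (fun t => h (t + c) - h c).
Proof.
move=> [h0 hi hc [h' [hK h'K h'c]]]; split.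
- by rewrite add0r subrr.
- by move=> a b ab; rewrite ltrD2r hi// ltrD2r.
- move=> x; apply: cvgB; last exact: cvg_cst.
  apply: (@continuous_comp _ _ _ (+%R^~ c) h); last exact: hc.
  by apply: cvgD; [exact: cvg_id|exact: cvg_cst].
- exists (fun u => h' (u + h c) - c); split.
  + by move=> x /=; rewrite subrK hK addrK.
  + by move=> x /=; rewrite subrK h'K addrK.
  + move=> x; apply: cvgB; last exact: cvg_cst.
    apply: (@continuous_comp _ _ _ (+%R^~ (h c)) h'); last exact: h'c.
    by apply: cvgD; [exact: cvg_id|exact: cvg_cst].
Qed.

(** The upper slope gives continuity; the lower one gives strict monotonicity, surjectivity by the
    intermediate value theorem, and an inverse that is Lipschitz with constant [c^-1]. *)
Lemma Rep_bilipschitz h c C : h 0 = 0 -> 0 < c ->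
  (forall s t, s <= t -> c * (t - s) <= h t - h s <= C * (t - s)) -> Rep h.
Proof.
move=> h0 c0 hcC.
have hinc s t : s < t -> h s < h t.
  move=> st; have /andP[+ _] := hcC _ _ (ltW st).
  by rewrite -subr_gt0; apply: lt_le_trans; rewrite mulr_gt0// subr_gt0.
have hle s t : s <= t -> h s <= h t.
  by rewrite le_eqVlt => /predU1P[->//|/hinc/ltW].
have hcont : continuous h.
  apply: (@lipschitz_continuous_real _ C) => s t st.
  by rewrite ger0_norm ?subr_ge0 ?hle//; have /andP[] := hcC _ _ st.
have hsurj u : exists t, h t = u.
  have b0 : 0 <= `|u| / c by rewrite divr_ge0// ltW.
  have [] := @IVT R h (- (`|u| / c)) (`|u| / c) u; first lra.
  - by apply: continuous_subspaceT.
  - have hb : `|u| <= h (`|u| / c).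
      have /andP[+ _] := hcC _ _ b0; rewrite h0 !subr0 mulrC divfK//.
      exact: lt0r_neq0.
    have ha : h (- (`|u| / c)) <= - `|u|.
      have /andP[+ _] := hcC (- (`|u| / c)) 0 ltac:(lra).
      rewrite h0 sub0r opprK sub0r mulrC divfK; first lra.
      exact: lt0r_neq0.
    have := ler_norm u; have := ler_norm (- u); rewrite normrN => u1 u2.
    by rewrite ge_min le_max; apply/andP; split; apply/orP; [left|right]; lra.
  - by move=> t _ <-; exists t.
have [g gh] := choice hsurj.
have hinj : injective h.
  move=> s t; case: (ltgtP s t) => // /hinc + E; by rewrite E ltxx.
have hg : cancel h g by move=> t; apply: hinj; rewrite gh.
split => //; exists g; split => //.
apply: (@lipschitz_continuous_real _ c^-1) => s t st.
have gst : g s <= g t.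
  by rewrite leNgt; apply/negP => /hinc; rewrite !gh ltNge st.
rewrite ger0_norm ?subr_ge0// mulrC ler_pdivlMr// mulrC.
by have /andP[+ _] := hcC _ _ gst; rewrite !gh.
Qed.

Definition interp (a : int -> R) (t : R) : R :=
  let k := Num.floor t in a k + (t - k%:~R) * (a (k + 1) - a k).

Lemma interp_nondecreasing (a : int -> R) s t :
  (forall k, a k <= a (k + 1)) -> s <= t -> interp a s <= interp a t.
Proof.
move=> ai st.
have lo u : a (Num.floor u) <= interp a u.
  by rewrite /interp lerDl mulr_ge0// subr_ge0// floor_le.
have hi u : interp a u <= a (Num.floor u + 1).
  have := floorD1_gt u; rewrite intrD mulr1z => /ltW u1.
  have := ai (Num.floor u); rewrite -subr_ge0 => a1.
  rewrite /interp -lerBrDl ler_piMl//; lra.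
have ai' j k : j <= k -> a j <= a k.
  move=> jk; have [n ->] : exists n : nat, k = j + n%:Z.
    by exists `|k - j|%N; rewrite gez0_abs ?subr_ge0// [RHS]addrC subrK.
  elim: n => [|n IH]; first by rewrite addr0.
  by apply: le_trans IH _; rewrite -addn1 PoszD addrA ai.
have := le_floor st; rewrite le_eqVlt => /predU1P[E|lt_fl].
  rewrite /interp E lerD2l ler_wpM2r ?subr_ge0// lerD2r//.
apply: le_trans (hi s) _; apply: le_trans (lo t); apply: ai'.
by rewrite lezD1.
Qed.

(** Interpolation is linear in the data and exact on linear sequences, so both bounds are
    monotonicity for the sequences [a k - c * k] and [C * k - a k]. *)
Lemma interp_bounds (a : int -> R) c C s t :
  (forall k, c <= a (k + 1) - a k <= C) -> s <= t ->
  c * (t - s) <= interp a t - interp a s <= C * (t - s).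
Proof.
move=> aC st; apply/andP; split.
  have := @interp_nondecreasing (fun k => a k - c * k%:~R) s t _ st.
  rewrite /interp !intrD !mulr1z => H.
  have {}H := H (fun k => ltac:(have /andP[] := aC k; rewrite intrD mulr1z; lra)).
  nra.
have := @interp_nondecreasing (fun k => C * k%:~R - a k) s t _ st.
rewrite /interp !intrD !mulr1z => H.
have {}H := H (fun k => ltac:(have /andP[] := aC k; rewrite intrD mulr1z; lra)).
nra.
Qed.

Lemma interp_int (a : int -> R) (k : int) : interp a k%:~R = a k.
Proof. by rewrite /interp intrKfloor subrr mul0r addr0. Qed.

(* The limit of reparametrizations need not be strictly monotone or continuous;
   interpolating its values on a grid repairs this. *)
Lemma Rep_interp (a : int -> R) c C (sigma : R) :
  0 < c -> 0 < sigma -> a 0 = 0 -> (forall k, c <= a (k + 1) - a k <= C) ->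
  Rep (fun t => interp a (t / sigma)) /\
  forall t, exists k : int, [/\ 0 <= t - k%:~R * sigma,
      t - k%:~R * sigma <= sigma,
      0 <= interp a (t / sigma) - a k & interp a (t / sigma) - a k <= C].
Proof.
move=> c0 s0 a0 aC; split.
  apply: (@Rep_bilipschitz _ (c / sigma) (C / sigma)).
  - by rewrite mul0r; have := interp_int a 0; rewrite a0.
  - exact: divr_gt0.
  - move=> s t st.
    have := @interp_bounds a c C (s / sigma) (t / sigma) aC.
    rewrite ler_pM2r ?invr_gt0// => /(_ st).
    by rewrite -mulrBl !mulrA ![_ * (t - s) / sigma]mulrAC.
move=> t; pose k := Num.floor (t / sigma); exists k.
have k1 : k%:~R <= t / sigma := floor_le _.
have k2 : t / sigma <= k%:~R + 1.
  by have := floorD1_gt (t / sigma); rewrite intrD mulr1z => /ltW.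
have /andP[kc kC] := @interp_bounds a c C k%:~R (t / sigma) aC k1.
rewrite interp_int in kc kC.
have k1' := k1; rewrite ler_pdivlMr// in k1'.
have k2' := k2; rewrite ler_pdivrMr// in k2'.
have /andP[cC1 cC2] := aC 0.
split; [lra|lra|nra|nra].
Qed.
End Reparametrizations.

(** * Continuity and compactness for flows *)

Section Flows.
Set Implicit Arguments.
Unset Strict Implicit.
Context {R : realType} {X : metricType R} {phi : R -> X -> X}.
Context (cX : compact [set: X]).
Context (flow : is_flow phi).
Implicit Types (x y z : X) (s t u : R).

Local Notation d := (@mdist R X).

Lemma flow0 x : phi 0 x = x. Proof. by case: flow. Qed.

Lemma flowD t s x : phi (t + s) x = phi s (phi t x).
Proof. by case: flow. Qed.

Lemma flowK t x : phi (- t) (phi t x) = x.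
Proof. by rewrite -flowD subrr flow0. Qed.

Lemma flow_cvg {I : Type} (F : set_system I) (t_ : I -> R) (x_ : I -> X) t x :
  Filter F -> t_ i @[i --> F] --> t -> x_ i @[i --> F] --> x ->
  phi (t_ i) (x_ i) @[i --> F] --> phi t x.
Proof.
move=> FF tt xx; have [phic _ _] := flow.
exact: (cvg_comp2 tt xx (phic (t, x))).
Qed.

Lemma continuous_orbit_map x : continuous (fun t => phi t x).
Proof.
move=> t; exact: (flow_cvg _ (@cvg_id _ (nbhs t)) (cvg_cst x)).
Qed.

Lemma cvg_dist_lt {I : Type} (F : set_system I) (x_ : I -> X) x (e : R) :
  x_ i @[i --> F] --> x -> 0 < e -> \forall i \near F, d x (x_ i) < e.
Proof. by move=> xx e0; have := xx _ (nbhsx_ballx x e e0); rewrite ballEmdist. Qed.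

Lemma dist_cvg_le {I : Type} (F : set_system I) (x_ y_ : I -> X) x y (e : R) :
  ProperFilter F -> x_ i @[i --> F] --> x -> y_ i @[i --> F] --> y ->
  (\forall i \near F, d (x_ i) (y_ i) <= e) -> d x y <= e.
Proof.
move=> FF xx yy de; apply/ler_addgt0Pr => r r0.
have r20 : 0 < r / 2 by rewrite divr_gt0.
have Hx := cvg_dist_lt xx r20.
have Hy := cvg_dist_lt yy r20.
have [i [[xi yi] di]] := filter_ex (filterI (filterI Hx Hy) de).
have := metric_triangle x (x_ i) y; have := metric_triangle (x_ i) (y_ i) y.
rewrite [d (y_ i) y]metric_sym; lra.
Qed.

(** The near-covering form of compactness makes joint continuity at [(0, x)] uniform in [x]. *)
Lemma small_moves (r : R) : 0 < r ->
  exists2 s, 0 < s & forall x t, `|t| <= s -> d (phi t x) x < r.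
Proof.
move=> r0; have [phic _ _] := flow.
have /compact_near_coveringP cov := cX.
have r20 : 0 < r / 2 by rewrite divr_gt0.
have : \forall t \near (0 : R), [set: X] `<=` (fun x => d (phi t x) x < r).
  apply: (cov R (nbhs (0 : R)) (fun t x => d (phi t x) x < r)) => x _.
  have Hp := phic (0, x).
  have /(_ _ (nbhsx_ballx _ _ r20)) := Hp; rewrite /= flow0.
  case=> -[A B] /= [A0 Bx] AB.
  have Bx' : nbhs x (B `&` ball x (r / 2)).
    by apply: filterI => //; exact: nbhsx_ballx.
  exists (B `&` ball x (r / 2), A) => //= -[x' t] /= [[Bx1 x1] At].
  have := AB (t, x') (conj At Bx1); rewrite !ballEmdist /= in x1 *.
  have := metric_triangle (phi t x') x x'.
  rewrite [d _ x]metric_sym; lra.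
case=> e /= e0 He; exists (e / 2); first exact: divr_gt0.
move=> x t te; apply: (He t) => //=; rewrite sub0r normrN; lra.
Qed.

Lemma fixed_mul t x : phi t x = x -> forall k : int, phi (k%:~R * t) x = x.
Proof.
move=> tx; have Hn (n : nat) : phi (n%:R * t) x = x.
  elim: n => [|n IH]; first by rewrite mul0r flow0.
  by rewrite -natr1 mulrDl mul1r flowD IH.
case=> n; first by rewrite -pmulrn.
by rewrite NegzE mulrNz -pmulrn mulNr -{1}(Hn n.+1) flowK.
Qed.

Lemma exists_ultra_nat : exists F : set_system nat, UltraFilter F /\
  forall n, \forall i \near F, (n <= i)%N.
Proof.
have [F [FU FF]] := ultraFilterLemma (F := \oo) _.
exists F; split => // n; apply: FF; exact: nbhs_infty_ge.
Qed.

End Flows.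

(** * Consequences of the absence of singularities *)

Section NoSingularity.
Set Implicit Arguments.
Unset Strict Implicit.
Context {R : realType} {X : metricType R} {phi : R -> X -> X}.
Context (cX : compact [set: X]).
Context (flow : is_flow phi).
Context (nosing : forall x, ~ singularity phi x).
Implicit Types (x y z : X) (s t u : R) (h : R -> R).

Local Notation d := (@mdist R X).

Lemma X_ultra_cvg {I : Type} (F : set_system I) (x_ : I -> X) :
  UltraFilter F -> exists x, x_ i @[i --> F] --> x.
Proof.
move=> FU; have [|x _ xx] := ultra_cvg_compact (f := x_) FU cX; last by exists x.
exact: nearW.
Qed.

Lemma cvg_invn {F : set_system nat} : Filter F ->
  (forall n, \forall i \near F, (n <= i)%N) ->
  forall e : R, 0 < e -> \forall i \near F, i.+1%:R^-1 < e.
Proof.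
move=> FF Finf e e0; apply: filterS (Finf (Num.truncn e^-1)) => i.
move=> Hi; rewrite invf_plt ?posrE//.
by apply: lt_le_trans (truncnS_gt _) _; rewrite ler_nat ltnS.
Qed.

(** Points with periods tending to 0 accumulate at a point fixed by the whole flow, which is a
    singularity. *)
Lemma no_short_period : exists2 T : R, 0 < T & forall t x, 0 < t < T -> phi t x <> x.
Proof.
apply: contrapT => H.
have {}H n : exists q : R * X, 0 < q.1 < n.+1%:R^-1 /\ phi q.1 q.2 = q.2.
  apply: contrapT => Hn; apply: H; exists (n.+1%:R^-1); first by rewrite invr_gt0.
  by move=> t x tn tx; apply: Hn; exists (t, x).
have [q Hq] := choice H.
have [F [FU Finf]] := exists_ultra_nat.
have [x qx] := X_ultra_cvg (fun n => (q n).2) FU.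
have FP : ProperFilter F by apply: ultra_proper.
have fixx s : phi s x = x.
  have H1 : phi s (q n).2 @[n --> F] --> phi s x.
    exact: (flow_cvg flow _ (cvg_cst s) qx).
  have H2 : phi s (q n).2 @[n --> F] --> x.
    rewrite -[X in _ --> X](flow0 flow x).
    (* Removing whole periods from [s] leaves a remainder smaller than [(q n).1], hence tending to
       0. *)
    pose k n := Num.floor (s / (q n).1).
    have -> : (fun n => phi s (q n).2) =
        (fun n => phi (s - (k n)%:~R * (q n).1) (q n).2).
      apply: funext => n; have [_ qn] := Hq n.
      rewrite -[in LHS](subrK ((k n)%:~R * (q n).1) s).
      rewrite [in LHS]addrC [in LHS](flowD flow).
      by rewrite (fixed_mul flow qn).
    apply: (flow_cvg flow _ _ qx).
    apply/cvgrPdist_lt => e e0.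
    apply: filterS (cvg_invn _ Finf e0) => n ne.
    have [/andP[q0 qn] _] := Hq n; rewrite sub0r normrN.
    have k1 : (k n)%:~R <= s / (q n).1 := floor_le _.
    have k2 := floorD1_gt (s / (q n).1); rewrite -/(k n) intrD mulr1z in k2.
    rewrite ler_pdivlMr// in k1; rewrite ltr_pdivrMr// in k2.
    rewrite ger0_norm ?subr_ge0//; rewrite mulrDl mul1r in k2.
    apply: lt_trans ne; apply: le_lt_trans qn.
    by rewrite lerBlDl; exact: ltW.
  exact: (@cvg_unique _ (metric_hausdorff (T := X)) (phi s (q n).2 @[n --> F])
    _ _ _ H1 H2).
apply: (@nosing x); split.
  by exists 1; split=> // t; rewrite !fixx.
rewrite /period.
have -> : [set T : R | 0 < T /\ forall t, phi (t + T) x = phi t x] = `]0, +oo[%classic.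
  apply/seteqP; split => T /=; rewrite in_itv/= andbT; first by case.
  by move=> T0; split => // t; rewrite !fixx.
apply/eqP; rewrite eq_le; apply/andP; split.
  apply/ler_addgt0Pr => e e0; rewrite add0r; apply: ge_inf.
    by exists 0 => y /=; rewrite in_itv/= andbT => /ltW.
  by rewrite /= in_itv/= andbT.
apply: lb_le_inf; first by exists 1; rewrite /= in_itv/= andbT.
by move=> y /=; rewrite in_itv/= andbT => /ltW.
Qed.

Lemma displacement_gap (tau : R) : (forall x, phi tau x <> x) ->
  exists2 g : R, 0 < g & forall x, g <= d (phi tau x) x.
Proof.
move=> Htau; apply: contrapT => H.
have {}H n : exists x, d (phi tau x) x < n.+1%:R^-1.
  apply: contrapT => Hn; apply: H; exists (n.+1%:R^-1); first by rewrite invr_gt0.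
  by move=> x; rewrite leNgt; apply/negP => Hx; apply: Hn; exists x.
have [x_ Hx] := choice H.
have [F [FU Finf]] := exists_ultra_nat.
have [x xx] := X_ultra_cvg x_ FU.
apply: (Htau x); apply: mdist_positivity; apply/eqP; rewrite eq_le mdist_ge0 andbT.
apply/ler_addgt0Pr => e e0; rewrite add0r.
have Fx : phi tau (x_ n) @[n --> F] --> phi tau x.
  exact: (flow_cvg flow _ (cvg_cst tau) xx).
apply: (dist_cvg_le _ Fx xx).
apply: filterS (cvg_invn _ Finf e0) => n ne.
exact: ltW (lt_trans (Hx n) ne).
Qed.

(* [h] advances by at most [tau] in time [sigma], since otherwise one point
   moves by the gap while its companion hardly moves. *)
Lemma rate_bounds (tau : R) : 0 < tau -> (forall x, phi tau x <> x) ->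
  exists sigma e : R, [/\ 0 < sigma, sigma <= tau, 0 < e &
    forall y z h t, Rep h ->
      (forall t', t <= t' <= t + sigma ->
        (forall s, t <= s <= t' -> d (phi s y) (phi (h s) z) < e) ->
        h t' - h t <= tau) /\
      (d (phi t y) (phi (h t) z) < e ->
       d (phi (t + tau) y) (phi (h (t + tau)) z) < e ->
        sigma <= h (t + tau) - h t)].
Proof.
move=> tau0 Htau; have [g g0 Hg] := displacement_gap Htau.
have g30 : 0 < g / 3 by rewrite divr_gt0.
have [s s0 Hs] := small_moves cX flow g30.
pose sigma := Num.min s tau.
have [sigma_s sigma_tau] : sigma <= s /\ sigma <= tau.
  by rewrite !ge_min !lexx orbT.
exists sigma, (g / 3); split => //; first by rewrite lt_min s0.
move=> y z h t Rh.
have [k [Rk hk kh]] := Rep_inverse Rh.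
have Hs' x a b : a <= b -> b - a <= sigma -> d (phi b x) (phi a x) < g / 3.
  move=> ab abs; rewrite -(subrK a b) addrC (flowD flow).
  by apply: Hs; rewrite ger0_norm ?subr_ge0// (le_trans abs).
have Hg' x a : g <= d (phi (a + tau) x) (phi a x) by rewrite (flowD flow).
split.
  move=> t1 /andP[tt1 t1s] close; rewrite leNgt; apply/negP => hbig.
  (* At time [t'] the companion has advanced by exactly [tau], hence moved by at least [g], while
     [y] has moved by less than [g / 3]. *)
  pose t' := k (h t + tau).
  have ht' : h t' = h t + tau by rewrite /t' kh.
  have [_ hi _ _] := Rh.
  have tt' : t <= t'.
    by rewrite leNgt; apply/negP => /hi; rewrite ht'; lra.
  have t't : t' <= t1.
    by rewrite leNgt; apply/negP => /hi; rewrite ht'; lra.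
  have c1 := close t ltac:(lra).
  have c2 := close t' ltac:(lra).
  have := Hg' z (h t); rewrite -ht'.
  have m := Hs' y t t' tt' ltac:(lra).
  have := metric_triangle (phi (h t') z) (phi t' y) (phi (h t) z).
  have := metric_triangle (phi t' y) (phi t y) (phi (h t) z).
  by rewrite [d (phi (h t') z) (phi t' y)]metric_sym; lra.
(* Here the roles are exchanged: [y] moves by at least [g] during [tau], while [z] would hardly
   move. *)
move=> c1 c2; rewrite leNgt; apply/negP => hsmall.
have hle : h t <= h (t + tau) by apply: (Rep_le Rh); lra.
have m := Hs' z _ _ hle (ltW hsmall).
have := Hg' y t.
have := metric_triangle (phi (t + tau) y) (phi (h (t + tau)) z) (phi t y).
have := metric_triangle (phi (h (t + tau)) z) (phi (h t) z) (phi t y).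
by rewrite [d (phi (h t) z) (phi t y)]metric_sym; lra.
Qed.

(** Chains [rate_bounds] over equal steps. The bounds are uniform in the points and in [h], so they
    control the real time that any shadow spends on a leg of a pseudo-orbit. *)
Lemma duration_bounds : exists2 e : R, 0 < e &
  (forall D : R, 0 < D -> exists M : R, forall y z h s0, Rep h ->
    (forall s, s0 <= s <= s0 + D -> d (phi (s - s0) y) (phi (h s) z) < e) ->
    h (s0 + D) - h s0 <= M) /\
  (forall M : R, exists D0 : R, forall D y z h s0, D0 <= D -> Rep h ->
    (forall s, s0 <= s <= s0 + D -> d (phi (s - s0) y) (phi (h s) z) < e) ->
    M <= h (s0 + D) - h s0).
Proof.
have [T T0 HT] := no_short_period.
have tau0 : 0 < T / 2 by rewrite divr_gt0.
have [sig [e [sig0 sig_tau e0 Hr]]] :=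
  rate_bounds tau0 (fun x => HT (T / 2) x ltac:(lra)).
set tau := T / 2 in tau0 sig_tau Hr.
have base y s0 s : phi (s - s0) y = phi s (phi (- s0) y) by rewrite addrC (flowD flow).
exists e => //; split.
  (* With [m] steps each has length at most [sig], and [h] advances by at most [tau] on it. *)
  move=> D D0; pose m := (Num.truncn (D / sig)).+1.
  exists (m%:R * tau) => y z h s0 Rh close.
  have m0 : 0 < m%:R :> R by rewrite ltr0n.
  have Dm : D / m%:R <= sig.
    by rewrite ler_pdivrMr// mulrC -ler_pdivrMr//; apply/ltW/truncnS_gt.
  have Dm0 : 0 < D / m%:R by rewrite divr_gt0.
  have steps n : (n <= m)%N -> h (s0 + n%:R * (D / m%:R)) - h s0 <= n%:R * tau.
    elim: n => [|n IH] nm; first by rewrite !mul0r addr0 subrr.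
    have {}IH := IH (ltnW nm).
    set t := s0 + n%:R * _ in IH.
    have tE : s0 + n.+1%:R * (D / m%:R) = t + D / m%:R.
      by rewrite -natr1 mulrDl mul1r addrA.
    have t0 : s0 <= t by rewrite lerDl mulr_ge0// ltW.
    have tD : s0 + n.+1%:R * (D / m%:R) <= s0 + D.
      rewrite lerD2l mulrCA ger_pMr// ler_pdivrMr// mul1r ler_nat//.
    rewrite tE in tD *; rewrite -natr1 mulrDl mul1r.
    have := (Hr (phi (- s0) y) z h t Rh).1 (t + D / m%:R) ltac:(lra).
    move=> H; have {}H := H (fun s Hs => ltac:(rewrite -base; apply: close; lra)).
    lra.
  have := steps m (leqnn m); rewrite [_ * (D / _)]mulrC divfK//.
  exact: lt0r_neq0.
(* Each step of length [tau] gains at least [sig], and [n * sig] exceeds [M]. *)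
move=> M; pose n := (Num.truncn (M / sig)).+1.
exists (n%:R * tau) => D y z h s0 nD Rh close.
have steps k : (k <= n)%N -> k%:R * sig <= h (s0 + k%:R * tau) - h s0.
  elim: k => [|k IH] kn; first by rewrite !mul0r addr0 subrr.
  have {}IH := IH (ltnW kn).
  set t := s0 + k%:R * _ in IH.
  have tE : s0 + k.+1%:R * tau = t + tau by rewrite -natr1 mulrDl mul1r addrA.
  have t0 : s0 <= t by rewrite lerDl mulr_ge0// ltW.
  have tD : s0 + k.+1%:R * tau <= s0 + D.
    by rewrite lerD2l; apply: le_trans nD; rewrite ler_wpM2r// ?ler_nat// ltW.
  rewrite tE in tD *; rewrite -natr1 mulrDl mul1r.
  have c1 : d (phi t (phi (- s0) y)) (phi (h t) z) < e.
    by rewrite -base; apply: close; lra.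
  have c2 : d (phi (t + tau) (phi (- s0) y)) (phi (h (t + tau)) z) < e.
    by rewrite -base; apply: close; lra.
  have := (Hr (phi (- s0) y) z h t Rh).2 c1 c2; lra.
have := steps n (leqnn n).
have : h (s0 + n%:R * tau) <= h (s0 + D) by apply: (Rep_le Rh); rewrite lerD2l.
have : M < n%:R * sig by rewrite -ltr_pdivrMr// truncnS_gt.
lra.
Qed.

End NoSingularity.

(** * Limits of reparametrizations and expansivity *)

Section LimitShadow.
Set Implicit Arguments.
Unset Strict Implicit.
Context {R : realType} {X : metricType R} {phi : R -> X -> X}.
Context (cX : compact [set: X]).
Context (flow : is_flow phi).
Context (nosing : forall x, ~ singularity phi x).
Implicit Types (x y z : X) (s t u : R) (h : R -> R).

Local Notation d := (@mdist R X).

(** Only the values of [h_ i] on the grid of step [sig] pass to the limit. Their increments stay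
    between [c] and [tau], and between grid points both orbits move by less than [rho / 4]. *)
Lemma limit_reparametrization (rho : R) : 0 < rho ->
  exists2 e : R, 0 < e & forall (I : Type) (F : set_system I)
    (y_ z_ : I -> X) (h_ : I -> R -> R) y z, UltraFilter F ->
    y_ i @[i --> F] --> y -> z_ i @[i --> F] --> z -> (forall i, Rep (h_ i)) ->
    (forall M : R, \forall i \near F, forall t, `|t| <= M ->
      d (phi t (y_ i)) (phi (h_ i t) (z_ i)) < e) ->
    exists H, Rep H /\ forall t, d (phi t y) (phi (H t) z) < rho.
Proof.
move=> rho0; have r40 : 0 < rho / 4 by rewrite divr_gt0.
have [s1 s10 Hs1] := small_moves cX flow r40.
have [T0 T00 HT0] := no_short_period cX flow nosing.
pose tau := Num.min s1 (T0 / 2).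
have tau0 : 0 < tau by rewrite lt_min s10 divr_gt0.
have [tau_s1 tau_T0] : tau <= s1 /\ tau < T0.
  by split; [rewrite ge_min lexx|rewrite gt_min; apply/orP; right; lra].
have [sig [e1 [sig0 sig_tau e10 Hsig]]] :=
  rate_bounds cX flow tau0 (fun x => HT0 tau x ltac:(lra)).
(* The first application bounds the increments above by [tau]; this one, with time step [sig],
   bounds them below by [c]. *)
have [c [e2 [c0 c_sig e20 Hc]]] :=
  rate_bounds cX flow sig0 (fun x => HT0 sig x ltac:(lra)).
pose e := Num.min (Num.min e1 e2) (rho / 4).
have [ee1 ee2 er] : [/\ e <= e1, e <= e2 & e <= rho / 4].
  by rewrite !ge_min !lexx !orbT.
exists e; first by rewrite !lt_min e10 e20.
move=> I F y_ z_ h_ y z FU yy zz Rh close.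
have FP : ProperFilter F by apply: ultra_proper.
have incr (k : int) : \forall i \near F,
    c <= h_ i ((k + 1)%:~R * sig) - h_ i (k%:~R * sig) <= tau.
  apply: filterS (close (`|k%:~R * sig| + sig)) => i Hi.
  have -> : (k + 1)%:~R * sig = k%:~R * sig + sig.
    by rewrite intrD mulr1z mulrDl mul1r.
  set t := k%:~R * sig in Hi *.
  have Hn u : 0 <= u <= sig -> `|t + u| <= `|t| + sig.
    by move=> u0; apply: le_trans (ler_normD _ _) _; rewrite lerD2l ger0_norm; lra.
  apply/andP; split.
    apply: (Hc _ _ _ _ (Rh i)).2.
    - apply: lt_le_trans ee2; apply: Hi.
      by have := Hn 0; rewrite addr0; apply; lra.
    - by apply: lt_le_trans ee2; apply: Hi; apply: Hn; lra.
  have [+ _] := Hsig (y_ i) (z_ i) (h_ i) t (Rh i).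
  move=> /(_ (t + sig)); apply; first lra.
  move=> s Hs.
  apply: lt_le_trans ee1; apply: Hi.
  by have := Hn (s - t); rewrite (addrC t) subrK; apply; lra.
have lim k : exists a : R, h_ i (k%:~R * sig) @[i --> F] --> a.
  (* Starting from [h_ i 0 = 0], the increment bounds confine each grid value to a compact segment
     for [F]-almost all [i]. *)
  have [M HM] : exists M, \forall i \near F, h_ i (k%:~R * sig) \in `[- M, M].
    elim/int_rect: k => [|n [M HM]|n [M HM]].
    - exists 0; apply: nearW => i; rewrite mul0r; have [-> _ _ _] := Rh i.
      by rewrite in_itv/= oppr0 lexx.
    - exists (M + tau); apply: filterS2 HM (incr n) => i.
      rewrite !in_itv/= -addn1 PoszD; lra.
    - exists (M + tau); apply: filterS2 HM (incr (- n.+1%:Z)) => i.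
      have -> : - n.+1%:Z + 1 = - n%:Z by rewrite -addn1 PoszD opprD addrNK.
      rewrite !in_itv/=; lra.
  have [a _ aF] := ultra_cvg_compact FU (@segment_compact R (- M) M) HM.
  by exists a.
have [a Ha] := choice lim.
have a0 : a 0 = 0.
  apply: (@cvg_unique _ (@Rhausdorff R) (h_ i (0 * sig) @[i --> F])); first exact: Ha.
  have -> : (fun i => h_ i (0 * sig)) = (fun=> 0).
    by apply: funext => i; rewrite mul0r; have [-> _ _ _] := Rh i.
  exact: cvg_cst.
have ainc k : c <= a (k + 1) - a k <= tau.
  have H : h_ i ((k + 1)%:~R * sig) - h_ i (k%:~R * sig) @[i --> F]
      --> a (k + 1) - a k.
    exact: cvgB (Ha (k + 1)) (Ha k).
  apply/andP; split.
    by apply: (cvgr_to_ge H); apply: filterS (incr k) => i /andP[].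
  by apply: (cvgr_to_le H); apply: filterS (incr k) => i /andP[].
have aclose k : d (phi (k%:~R * sig) y) (phi (a k) z) <= e.
  apply: (dist_cvg_le _ (flow_cvg flow _ (cvg_cst (k%:~R * sig)) yy)
    (flow_cvg flow _ (Ha k) zz)).
  by apply: filterS (close `|k%:~R * sig|) => i Hi; apply/ltW/Hi.
have [RH HH] := Rep_interp c0 sig0 a0 ainc.
exists (fun t => interp a (t / sig)); split => // t.
have [k [k1 k2 k3 k4]] := HH t.
set Ht := interp a _ in k3 k4 *.
have m1 : d (phi t y) (phi (k%:~R * sig) y) < rho / 4.
  rewrite -[X in phi X y](subrK (k%:~R * sig)) addrC (flowD flow).
  by apply: Hs1; rewrite ger0_norm//; lra.
have m2 : d (phi Ht z) (phi (a k) z) < rho / 4.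
  rewrite -[X in phi X z](subrK (a k)) addrC (flowD flow).
  by apply: Hs1; rewrite ger0_norm//; lra.
have := metric_triangle (phi t y) (phi (k%:~R * sig) y) (phi Ht z).
have := metric_triangle (phi (k%:~R * sig) y) (phi (a k) z) (phi Ht z).
have := aclose k; rewrite [d (phi (a k) z) _]metric_sym; lra.
Qed.

(* Uniform expansivity as defined yields only [y \in O(z)], whatever the
   bound on the time shift. *)
Lemma expansive_orbit p : uniformly_expansive phi p ->
  exists2 e : R, 0 < e & forall y z h t, Rep h ->
    (forall s, d (phi s y) (phi (h s) z) < e) -> d p (phi t y) < e ->
    exists s, y = phi s z.
Proof.
move=> [U [pU expU]]; have [dl [dl0 Hdl]] := expU 1 ltr01.
have [r r0 rU] : exists2 r : R, 0 < r & forall y, d p y < r -> U y.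
  have /nbhs_ballP[r /= r0 rU] := pU.
  by exists r => // y py; apply: rU; rewrite ballEmdist.
pose e := Num.min dl (r / 2).
have [e_dl e_r] : e <= dl /\ e <= r / 2 by rewrite !ge_min !lexx orbT.
exists e; first by rewrite lt_min dl0 divr_gt0.
move=> y z h t Rh close pt.
(* Expansivity is applied at time [t], when both orbits are near [p]; subtracting [h t] makes the
   shifted reparametrization vanish at 0. *)
have [||||w [s [[s' _ <-] [_ E]]]] :=
    Hdl (phi t y) (phi (h t) z) (fun s => h (s + t) - h t).
- by apply: rU; lra.
- apply: rU; have := close t; have := metric_triangle p (phi t y) (phi (h t) z); lra.
- exact: Rep_shift.
- move=> s; rewrite -!(flowD flow) [t + s]addrC [h t + _]addrC subrK.
  by apply: lt_le_trans e_dl.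
- exists (h t + s' + s - t); rewrite !(flowD flow) -E.
  by rewrite (flowK flow t y).
Qed.

Lemma periodic_orbit_compact x : Defs.periodic phi x -> compact (Defs.orbit phi x).
Proof.
move=> [T [T0 Tx]].
have TxE : phi T x = x by have := Tx 0; rewrite add0r (flow0 flow).
have -> : Defs.orbit phi x = (fun t => phi t x) @` `[0, T].
  apply/seteqP; split => y [t /= Ht <-]; last by exists t.
  pose k := Num.floor (t / T); exists (t - k%:~R * T).
    have k1 : k%:~R <= t / T := floor_le _.
    have k2 := floorD1_gt (t / T); rewrite -/k intrD mulr1z in k2.
    rewrite ler_pdivlMr// in k1; rewrite ltr_pdivrMr// mulrDl mul1r in k2.
    by rewrite /= in_itv/=; apply/andP; split; lra.
  rewrite -[in RHS](subrK (k%:~R * T) t) [in RHS]addrC [in RHS](flowD flow).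
  by rewrite (fixed_mul flow TxE).
apply: continuous_compact; last exact: segment_compact.
by apply: continuous_subspaceT; exact: continuous_orbit_map.
Qed.
End LimitShadow.

(** * Compact orbits are periodic *)

Section CompactOrbit.
Set Implicit Arguments.
Unset Strict Implicit.
Context {R : realType} {X : metricType R} {phi : R -> X -> X}.
Context (cX : compact [set: X]).
Context (flow : is_flow phi).
Implicit Types (x y z : X) (s t u : R) (h : R -> R).

Local Notation d := (@mdist R X).

Lemma periodic_of_return x T : 0 < T -> phi T x = x -> Defs.periodic phi x.
Proof.
by move=> T0 Tx; exists T; split => // t; rewrite addrC (flowD flow) Tx.
Qed.

Lemma nonperiodic_injective x s t : ~ Defs.periodic phi x ->
  phi s x = phi t x -> s = t.
Proof.
move=> nper; wlog st : s t / s <= t.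
  by move=> W; have [/W//|/ltW/W + /esym] := leP s t; move=> /[apply].
move=> E; apply/eqP; rewrite eq_le st leNgt; apply/negP => lt_st.
apply: nper; apply: (@periodic_of_return _ (t - s)); first by rewrite subr_gt0.
by rewrite (flowD flow) -E flowK.
Qed.

(* Baire category argument: a compact orbit is a countable union of arcs, and
   if it is not periodic, returns near any of its points occur off each arc. *)
Lemma compact_orbit_periodic x : compact (Defs.orbit phi x) -> Defs.periodic phi x.
Proof.
move=> cO; apply: contrapT => nper.
have [F [FU Finf]] := exists_ultra_nat.
have FP : ProperFilter F by apply: ultra_proper.
have [|_ [r _ <-] Hr] := ultra_cvg_compact (f := fun n => phi n%:R x) FU cO.
  by apply: nearW => n; exists n%:R.
(* The orbit returns near each of its points at arbitrarily large times. *)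
have ret t : phi (n%:R + (t - r)) x @[n --> F] --> phi t x.
  have -> : phi t x = phi (t - r) (phi r x) by rewrite -(flowD flow) addrC subrK.
  under eq_fun do rewrite (flowD flow).
  exact: (flow_cvg flow _ (cvg_cst (t - r)) Hr).
(* A pair [q] encodes the ball of radius [q.2] about [phi q.1 x]. The next ball lies inside it and
   misses the arc of times at most [k] in absolute value. The guard [0 < q.2] sits under the
   existential so that choice applies to all pairs. *)
have step (k : nat) (q : R * R) : exists q' : R * R, 0 < q.2 ->
    [/\ 0 < q'.2, d (phi q.1 x) (phi q'.1 x) + q'.2 <= q.2 &
      forall s, `|s| <= k%:R -> q'.2 < d (phi s x) (phi q'.1 x)].
  have [q0|q0] := ltP 0 q.2; last by exists q => ?; lra.
  have q20 : 0 < q.2 / 2 by rewrite divr_gt0.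
  have [n [n1 n2]] := filter_ex (filterI (cvg_dist_lt (ret q.1) q20)
      (Finf (Num.truncn (k%:R - (q.1 - r))).+1)).
  have n3 : k%:R < n%:R + (q.1 - r).
    rewrite -ltrBlDr; apply: lt_le_trans (truncnS_gt _) _; by rewrite ler_nat.
  set t' := n%:R + _ in n1 n3.
  pose A := (fun t => phi t x) @` `[- k%:R, k%:R].
  have cA : closed A.
    apply: compact_closed; first exact: metric_hausdorff.
    apply: continuous_compact; last exact: segment_compact.
    by apply: continuous_subspaceT; exact: continuous_orbit_map.
  have : nbhs (phi t' x) (~` A).
    apply: open_nbhs_nbhs; split; first exact: closed_openC.
    move=> [s /=]; rewrite in_itv/= => /andP[s1 s2] /(nonperiodic_injective nper) st'.
    by move: n3; rewrite -st' ltNge s2.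
  case/nbhs_ballP => g /= g0 gA; rewrite ballEmdist in gA.
  exists (t', Num.min (q.2 / 2) (g / 2)) => _ /=; split.
  - by rewrite lt_min q20 divr_gt0.
  - have : Num.min (q.2 / 2) (g / 2) <= q.2 / 2 by rewrite ge_min lexx.
    lra.
  - move=> s sk; have : Num.min (q.2 / 2) (g / 2) <= g / 2 by rewrite ge_min lexx orbT.
    have : g <= d (phi s x) (phi t' x).
      rewrite metric_sym leNgt; apply/negP => /gA; apply; exists s => //=.
      by rewrite in_itv/= -ler_norml.
    lra.
have [f Hf] := choice (fun kq : nat * (R * R) => step kq.1 kq.2).
pose u := fix u k := if k is k'.+1 then f (k', u k') else (0, 1) : R * R.
have u0 k : 0 < (u k).2.
  elim: k => [|k IH] /=; first exact: ltr01.
  by have [] := Hf (k, u k) IH.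
have um k j : d (phi (u k).1 x) (phi (u (j + k)%N).1 x) + (u (j + k)%N).2 <= (u k).2.
  elim: j => [|j IH]; first by rewrite mdistxx add0r.
  have [_ + _] := Hf ((j + k)%N, u (j + k)%N) (u0 _).
  rewrite addSn /=; set v := f _; set w := u (j + k)%N in IH *.
  have := metric_triangle (phi (u k).1 x) (phi w.1 x) (phi v.1 x); lra.
(* The centres converge to some [phi s x], which lies in all the closed balls; but the ball of index
   [k.+1] avoids it once [k] exceeds the absolute value of [s]. *)
have [|_ [s _ <-] Hs] := ultra_cvg_compact (f := fun n => phi (u n).1 x) FU cO.
  by apply: nearW => n; exists (u n).1.
pose k := (Num.truncn `|s|).+1.
have [_ _ /(_ s)] := Hf (k, u k) (u0 k).
rewrite -[f _]/(u k.+1) => /(_ (ltW (truncnS_gt _))).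
apply/negP; rewrite -leNgt metric_sym.
apply: (dist_cvg_le _ (cvg_cst (phi (u k.+1).1 x)) Hs).
apply: filterS (Finf k.+1) => n kn.
have := um k.+1 (n - k.+1)%N; rewrite subnK//.
by have := u0 n; lra.
Qed.
End CompactOrbit.

(** * Closing: periodic orbits near a non-wandering point *)

Lemma evenz_double (k : int) : ((2 * k) %% 2)%Z == 0.
Proof. by lia. Qed.

Lemma evenzS (i : int) : ((i + 1) %% 2 == 0)%Z = ~~ (i %% 2 == 0)%Z.
Proof. by lia. Qed.

Section Closing.
Set Implicit Arguments.
Unset Strict Implicit.
Context {R : realType} {X : metricType R} {phi : R -> X -> X}.
Context (cX : compact [set: X]).
Context (flow : is_flow phi).
Context (nosing : forall x, ~ singularity phi x).
Implicit Types (x y z : X) (s t u : R) (h : R -> R).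

Local Notation d := (@mdist R X).

Lemma sseqS (ts : int -> R) i : sseq ts (i + 1) = sseq ts i + ts i.
Proof.
case: i => [n|[|n]].
- by rewrite -PoszD addn1 /= big_ord_recr.
- by rewrite /= big_ord0 big_ord_recl big_ord0 addr0 addNr.
- have -> : Negz n.+1 + 1 = Negz n by rewrite !NegzE -addn1 PoszD opprD addrNK.
  by rewrite /= [in RHS]big_ord_recr /= opprD -NegzE addrNK.
Qed.

Lemma flow_continuous_at t p (e : R) : 0 < e ->
  exists2 e' : R, 0 < e' & forall x, d p x < e' -> d (phi t p) (phi t x) < e.
Proof.
move=> e0.
have H : phi t x @[x --> p] --> phi t p.
  exact: (flow_cvg flow _ (cvg_cst t) (@cvg_id _ (nbhs p))).
have /nbhs_ballP[e' /= e'0 He'] := cvg_dist_lt H e0.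
by exists e' => // x px; apply: He'; rewrite ballEmdist.
Qed.

Lemma nonwandering_return p (e T : R) : Omega phi p -> 0 < e -> 0 < T ->
  exists t x, [/\ T <= t, d p x < e & d p (phi t x) < e].
Proof.
move=> Op e0 T0; apply: contrapT => H; apply: Op.
exists (ball p e); split; first exact: nbhsx_ballx.
exists T; split => // t Tt; rewrite -subset0 => _ [[x px <-]] ptx.
by apply: H; exists t, x; rewrite ballEmdist in px ptx.
Qed.

(** Shifting a shadow by whole loops gives another shadow of the same loop. So each orbit point is
    compared with the one at the same phase of the first loop, and expansivity puts the limits of
    both on one orbit. *)
Lemma closing p (eta : R) : Omega phi p -> shadowable phi p ->
  uniformly_expansive phi p -> 0 < eta ->
  exists y, Defs.periodic phi y /\ d y p < eta.
Proof.
move=> Op shp uep eta0.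
have [e0 e00 He0] := expansive_orbit flow uep.
have [e1 e10 He1] := limit_reparametrization cX flow nosing e00.
pose eps := Num.min (Num.min eta e0) (e1 / 2).
have [eps_eta eps_e0 eps_e1] : [/\ eps <= eta, eps <= e0 & eps <= e1 / 2].
  by rewrite !ge_min !lexx !orbT.
have eps0 : 0 < eps by rewrite !lt_min eta0 e00 divr_gt0.
have [delta [delta0 Hdelta]] := shp eps eps0.
have [e2 e20 He2] := flow_continuous_at 1 p delta0.
(* A return time of at least 2 leaves a second leg with [t - 1 >= 1]. *)
have [t [x [t2 px pxt]]] := nonwandering_return Op
  (ltac:(by rewrite lt_min e20 delta0) : 0 < Num.min e2 delta) (ltr0n R 2).
have {}px : d p x < e2 by apply: lt_le_trans px _; rewrite ge_min lexx.
have {}pxt : d p (phi t x) < delta by apply: lt_le_trans pxt _; rewrite ge_min lexx orbT.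
(* Even legs follow [p] for time 1, odd legs follow [phi 1 x] for time [t - 1]: the loop has to
   start at [p] itself, not at [x]. *)
pose ev (i : int) := (i %% 2)%Z == 0.
pose xs i := if ev i then p else phi 1 x.
pose ts i : R := if ev i then 1 else t - 1.
have evS i : ev (i + 1) = ~~ ev i by exact: evenzS.
have ev2 k : ev (2 * k) by exact: evenz_double.
have s2 k : sseq ts (2 * k) = k%:~R * t.
  have S2 i : sseq ts (2 * (i + 1)) = sseq ts (2 * i) + t.
    have -> : 2 * (i + 1) = 2 * i + 1 + 1 by rewrite mulrDr mulr1 -addrA.
    by rewrite !sseqS /ts evS ev2 /=; lra.
  elim/int_rect: k => [|n IH|n IH].
  - by rewrite mulr0 /= big_ord0 mul0r.
  - by rewrite intS (addrC 1) S2 IH intrD mulr1z mulrDl mul1r.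
  - have -> : - n.+1%:Z = - n%:Z - 1 by rewrite intS opprD addrC.
    have := S2 (- n%:Z - 1); rewrite subrK IH intrB mulr1z mulrBl mul1r; lra.
have [] := Hdelta None None xs ts.
- by split.
- by rewrite /xs (ev2 0).
- split => [i _|i _ _]; first by rewrite /ts; case: (ev i); lra.
  rewrite /ts /xs evS; case: (ev i) => /=; first exact: He2.
  by rewrite -(flowD flow) addrC subrK metric_sym.
move=> q0 [h [Rh close]].
pose c s := if s <= 1 then phi s p else phi (s - 1) (phi 1 x).
have hc (k : int) s : 0 <= s <= t -> d (phi (h (k%:~R * t + s)) q0) (c s) < eps.
  move=> /andP[sge0 st]; rewrite /c.
  have S1 : sseq ts (2 * k + 1) = k%:~R * t + 1 by rewrite sseqS s2 /ts ev2.
  have S2 : sseq ts (2 * k + 1 + 1) = k%:~R * t + t.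
    by rewrite sseqS S1 /ts evS ev2 /=; lra.
  case: (leP s 1) => s1.
    have := close (2 * k) (conj I I) (k%:~R * t + s).
    rewrite S1 s2 /xs ev2 addrAC subrr add0r; apply; lra.
  have := close (2 * k + 1) (conj I I) (k%:~R * t + s).
  rewrite S2 S1 /xs evS ev2 /= opprD addrACA subrr add0r; apply; lra.
have t0 : 0 < t by lra.
(* Passages at the same phase are both [eps]-close to [c], and [2 * eps <= e1]. *)
have hcc (k m : int) s :
    d (phi (h (k%:~R * t + s)) q0) (phi (h (m%:~R * t + s)) q0) < e1.
  pose j := Num.floor (s / t).
  have j1 : j%:~R <= s / t := floor_le _.
  have j2 := floorD1_gt (s / t); rewrite -/j intrD mulr1z in j2.
  rewrite ler_pdivlMr// in j1; rewrite ltr_pdivrMr// mulrDl mul1r in j2.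
  have Hr : 0 <= s - j%:~R * t <= t by apply/andP; split; lra.
  have E (i : int) : i%:~R * t + s = (i + j)%:~R * t + (s - j%:~R * t).
    by rewrite intrD mulrDl; lra.
  rewrite !E; have := hc (k + j) _ Hr; have := hc (m + j) _ Hr.
  set a := phi _ q0; set b := phi _ q0; set cc := c _.
  have := metric_triangle b cc a; rewrite [d cc a]metric_sym; lra.
have h00 : h 0 = 0 by case: Rh.
have pq0 : d q0 p < eps.
  have := hc 0 0 ltac:(lra).
  by rewrite mul0r addr0 h00 (flow0 flow) /c ler01 (flow0 flow).
exists q0; split; last exact: lt_le_trans pq0 eps_eta.
apply: (compact_orbit_periodic flow); rewrite compact_ultra => F FU FO.
have FP : ProperFilter F by apply: ultra_proper.
have [z zF] := X_ultra_cvg cX id FU.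
exists z; split => //.
have [g [Rg hg gh]] := Rep_inverse Rh.
have orbit_time y : exists v, Defs.orbit phi q0 y -> phi v q0 = y.
  have [[v _ <-]|no] := pselect (Defs.orbit phi q0 y); first by exists v.
  by exists 0.
have [tm Htm] := choice orbit_time.
(* [s y] is the pseudo-orbit time of [y], and [s' y] its phase, which stays in the compact segment
   from 0 to [t]. *)
pose s y := g (tm y); pose k y := Num.floor (s y / t).
pose s' y := s y - (k y)%:~R * t.
have s't y : s' y \in `[0, t].
  have j1 : (k y)%:~R <= s y / t := floor_le _.
  have j2 := floorD1_gt (s y / t); rewrite -/(k y) intrD mulr1z in j2.
  rewrite ler_pdivlMr// in j1; rewrite ltr_pdivrMr// mulrDl mul1r in j2.
  by rewrite /s' in_itv/=; apply/andP; split; lra.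
have Fs' : \forall y \near F, s' y \in `[0, t] by exact: nearW.
have [s1 _ Hs1] := ultra_cvg_compact FU (@segment_compact R 0 t) Fs'.
pose y_ y := phi (h (s' y)) q0; pose z_ y := phi (h (s y)) q0.
have yF : y_ y @[y --> F] --> phi (h s1) q0.
  apply: (flow_cvg flow _ _ (cvg_cst q0)).
  by have [_ _ hcont _] := Rh; apply: cvg_comp Hs1 (hcont s1).
have zF' : z_ y @[y --> F] --> z.
  move=> A Az; have FA : F A := zF A Az.
  apply: (@filterS _ F _ (Defs.orbit phi q0 `&` A)); last exact: filterI.
  move=> y [Oy Ay].
  change (A (phi (h (g (tm y))) q0)); by rewrite gh (Htm y Oy).
(* Back to pseudo-orbit time by [g], forward by [k y] whole loops, then to real time again by
   [h]. *)
pose h_ y := (fun v => h (v + s y) - h (s y)) \o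
             (fun u => g (u + h (s' y)) - g (h (s' y))).
have [] := He1 _ F y_ z_ h_ _ _ FU yF zF'.
- by move=> y; apply: Rep_comp; exact: Rep_shift.
- move=> M; apply: nearW => y u _; rewrite /y_ /z_ /h_ /=.
  rewrite -!(flowD flow) [h (s' y) + u]addrC [h (s y) + _]addrC subrK.
  rewrite -{1}(gh (u + h (s' y))) hg.
  set v := g _.
  have := hcc 0 (k y) v; rewrite mul0r add0r.
  by have -> : (k y)%:~R * t + v = v - s' y + s y by rewrite /s'; lra.
move=> H [RH HH].
(* At time [- h s1] the limit of the [y_] passes through [q0], which is close to [p]. *)
have [|v E] := He0 _ _ _ (- h s1) RH HH.
  by rewrite (flowK flow) metric_sym; lra.
exists (h s1 - v) => //; by rewrite (flowD flow) E (flowK flow).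
Qed.
End Closing.

(** * Distinct periodic orbits do not fellow travel for long *)

Section FellowTravel.
Set Implicit Arguments.
Unset Strict Implicit.
Context {R : realType} {X : metricType R} {phi : R -> X -> X}.
Context (cX : compact [set: X]).
Context (flow : is_flow phi).
Context (nosing : forall x, ~ singularity phi x).
Implicit Types (x y z : X) (s t u : R) (h : R -> R).

Local Notation d := (@mdist R X).

(** Otherwise limits of recentred windows give a point of each orbit whose trajectories stay close
    forever up to reparametrization, and expansivity near [p] identifies the orbits. The phases [c]
    and [c'] are absorbed into the points [a] and [b]. *)
Lemma bounded_fellow_travel p : uniformly_expansive phi p ->
  exists2 e : R, 0 < e & forall yA yB, Defs.periodic phi yA ->
    Defs.periodic phi yB -> d p yA < e -> ~ Defs.orbit phi yB yA ->
  exists N : nat, forall x x' a b g g' (c c' u : R), Rep g -> Rep g' ->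
    Defs.orbit phi yA a -> Defs.orbit phi yB b ->
    (forall t, u <= t <= u + N%:R -> [/\ d (phi t x) (phi (g t - c) a) < e,
      d (phi t x') (phi (g' t - c') b) < e & d (phi t x) (phi t x') < e]) ->
    False.
Proof.
move=> uep; have [e0 e00 He0] := expansive_orbit flow uep.
have rho0 : 0 < e0 / 4 by rewrite divr_gt0.
have [e1 e10 He1] := limit_reparametrization cX flow nosing rho0.
pose e := Num.min e1 (e0 / 4).
have [ee1 ee0] : e <= e1 /\ e <= e0 / 4 by rewrite !ge_min !lexx orbT.
exists e; first by rewrite lt_min e10.
move=> yA yB perA perB pA nAB; apply: contrapT => noN.
have bad (n : nat) : exists w : (X * X) * (X * X) * ((R -> R) * (R -> R)),
    [/\ Rep w.2.1, Rep w.2.2,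
        Defs.orbit phi yA w.1.2.1, Defs.orbit phi yB w.1.2.2
      & forall t, `|t| <= n%:R ->
        [/\ d (phi t w.1.1.1) (phi (w.2.1 t) w.1.2.1) < e,
          d (phi t w.1.1.2) (phi (w.2.2 t) w.1.2.2) < e
        & d (phi t w.1.1.1) (phi t w.1.1.2) < e]].
  (* Twice [n], since the window is recentred at its midpoint [m]. *)
  apply: contrapT => nobad; apply: noN; exists (n + n)%N.
  move=> x x' a b g g' c c' u Rg Rg' [ra _ <-] [rb _ <-] H; apply: nobad.
  pose m := u + n%:R.
  exists ((phi m x, phi m x'),
          (phi (g m - c) (phi ra yA), phi (g' m - c') (phi rb yB)),
          ((fun t => g (t + m) - g m), (fun t => g' (t + m) - g' m))).
  split => /=; [exact: Rep_shift|exact: Rep_shift| | |].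
  - by exists (ra + (g m - c)); rewrite ?(flowD flow).
  - by exists (rb + (g' m - c')); rewrite ?(flowD flow).
  move=> t; rewrite ler_norml => tn.
  have := H (t + m); rewrite natrD => -[|H1 H2 H3]; first by rewrite /m; lra.
  rewrite -!(flowD flow) (addrC m t).
  have E k v (r : R) y : phi (r + (k m - v + (k (t + m) - k m))) y =
      phi (k (t + m) - v) (phi r y).
    by rewrite -(flowD flow); congr phi; lra.
  by split; rewrite ?E.
have [w Hw] := choice bad.
have [F [FU Finf]] := exists_ultra_nat.
have FP : ProperFilter F by apply: ultra_proper.
have [x xF] := X_ultra_cvg cX (fun n => (w n).1.1.1) FU.
have [x' xF'] := X_ultra_cvg cX (fun n => (w n).1.1.2) FU.
have [|a [ra _ Ea] aF] := ultra_cvg_compact (f := fun n => (w n).1.2.1) FU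
    (periodic_orbit_compact flow perA).
  by apply: nearW => n; have [] := Hw n.
have [|b [rb _ Eb] bF] := ultra_cvg_compact (f := fun n => (w n).1.2.2) FU
    (periodic_orbit_compact flow perB).
  by apply: nearW => n; have [] := Hw n.
have eventually (M : R) : \forall n \near F, M <= n%:R.
  apply: filterS (Finf (Num.truncn M).+1) => n nM.
  by apply/ltW/(lt_le_trans (truncnS_gt _)); rewrite ler_nat.
have [||H [RH HH]] := He1 _ F _ _ (fun n => (w n).2.1) _ _ FU xF aF.
- by move=> n; have [] := Hw n.
- move=> M; apply: filterS (eventually M) => n Mn t tM.
  have [_ _ _ _ /(_ t (le_trans tM Mn))[c1 _ _]] := Hw n.
  exact: lt_le_trans c1 ee1.
have [||H' [RH' HH']] := He1 _ F _ _ (fun n => (w n).2.2) _ _ FU xF' bF.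
- by move=> n; have [] := Hw n.
- move=> M; apply: filterS (eventually M) => n Mn t tM.
  have [_ _ _ _ /(_ t (le_trans tM Mn))[_ c1 _]] := Hw n.
  exact: lt_le_trans c1 ee1.
have xx' t : d (phi t x) (phi t x') <= e.
  apply: (dist_cvg_le _ (flow_cvg flow _ (cvg_cst t) xF)
    (flow_cvg flow _ (cvg_cst t) xF')).
  apply: filterS (eventually `|t|) => n nt.
  by have [_ _ _ _ /(_ t nt)[_ _ /ltW]] := Hw n.
(* [H' \o K] carries times on the orbit of [a] to times on that of [b]; three distances of at most
   [e0 / 4] are added. *)
have [K [RK HK KH]] := Rep_inverse RH.
have [||s E] := He0 a b (H' \o K) (- ra) (Rep_comp RH' RK).
- move=> s /=; rewrite -{1}(KH s); set t := K s.
  have := HH t; have := HH' t; have := xx' t.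
  have := metric_triangle (phi (H t) a) (phi t x) (phi (H' t) b).
  have := metric_triangle (phi t x) (phi t x') (phi (H' t) b).
  by rewrite [d (phi (H t) a) (phi t x)]metric_sym; lra.
- by rewrite -Ea (flowK flow); lra.
apply: nAB; exists (rb + s - ra) => //.
by rewrite !(flowD flow) Eb -E -Ea (flowK flow).
Qed.
End FellowTravel.

(** * Switching times determine the word *)

Section Itineraries.
Set Implicit Arguments.
Unset Strict Implicit.
Context {R : realType}.

(* [a] and [a'] are the switching times of two orbits following alternately
   two curves; when the orbits stay close, switches of equal index can differ
   by at most [L], so that short and long stays are distinguished. *)
Lemma switching_times_determine (L M0 M T : R) (n : nat)
    (b b' : nat -> bool) (a a' : nat -> R) :
  let timed (b : nat -> bool) (a : nat -> R) :=
    0 <= a 1%N <= L /\ forall i, (0 < i)%N ->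
      [/\ 3 * L <= a i.+1 - a i, a i.+1 - a i <= M,
          ~~ b i -> a i.+1 - a i <= M0 & b i -> M0 + 2 * L < a i.+1 - a i] in
  0 < L -> L <= M -> n.+2%:R * M <= T -> timed b a -> timed b' a' ->
  (forall i j u, (0 < i)%N -> (0 < j)%N -> odd i != odd j ->
     a i <= u -> u + L <= a i.+1 -> a' j <= u -> u + L <= a' j.+1 ->
     0 <= u -> u + L <= T -> False) ->
  forall i, (0 < i <= n)%N -> b i = b' i.
Proof.
move=> timed L0 LM nT [/andP[a10 a1L] Ha] [/andP[a10' a1L'] Ha'] no.
have abound (c : nat -> bool) (f : nat -> R) : 0 <= f 1%N <= L ->
    (forall i, (0 < i)%N -> [/\ 3 * L <= f i.+1 - f i, f i.+1 - f i <= M,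
      ~~ c i -> f i.+1 - f i <= M0 & c i -> M0 + 2 * L < f i.+1 - f i]) ->
    forall i, 0 <= f i.+1 <= i.+1%:R * M.
  move=> /andP[f0 fL] Hf; elim=> [|i /andP[IH0 IH]]; first by apply/andP; split; lra.
  have [f1 f2 _ _] := Hf i.+1 isT.
  by rewrite -natr1 mulrDl mul1r; apply/andP; split; lra.
have ab := abound b a ltac:(lra) Ha; have ab' := abound b' a' ltac:(lra) Ha'.
(* The windows used below end no later than a switch of index at most [n.+2], whence the factor in
   the bound on [T]. *)
have horizon i : (i <= n.+1)%N -> i.+1%:R * M <= T.
  by move=> ?; apply: le_trans nT; rewrite ler_wpM2r ?ler_nat//; lra.
(* If switches of equal index were more than [L] apart, the window of length [L] after the earlier
   one would lie in stays of different parity, against [no]. *)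
have aligned i : (i <= n)%N -> `|a i.+1 - a' i.+1| <= L.
  elim: i => [_|i IH lt_in]; first by rewrite ler_norml; apply/andP; split; lra.
  have := IH (ltnW lt_in); rewrite !ler_norml => /andP[IH1 IH2].
  have [g1 _ _ _] := Ha i.+1 isT; have [g2 _ _ _] := Ha i.+2 isT.
  have [g1' _ _ _] := Ha' i.+1 isT; have [g2' _ _ _] := Ha' i.+2 isT.
  have /andP[p2 _] := ab i.+1; have /andP[_ p3] := ab i.+2.
  have /andP[p2' _] := ab' i.+1; have /andP[_ p3'] := ab' i.+2.
  have hor := horizon i.+2 lt_in.
  apply/andP; split; rewrite leNgt; apply/negP => lt_a.
  - by apply: (no i.+2 i.+1 (a i.+2)) => //=; [case: odd|lra..].
  - by apply: (no i.+1 i.+2 (a' i.+2)) => //=; [case: odd|lra..].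
move=> [//|i] /= lt_in.
(* Both ends of a stay match up to [L], so the two lengths differ by at most [2 * L], too little to
   confuse short and long. *)
have := aligned i (ltnW lt_in); have := aligned i.+1 lt_in.
rewrite !ler_norml => /andP[] l1 l2 /andP[l3 l4].
have [_ _ s1 s2] := Ha i.+1 isT; have [_ _ s1' s2'] := Ha' i.+1 isT.
case: (b i.+1) (b' i.+1) s1 s2 s1' s2' => [] [] // s1 s2 s1' s2'; exfalso.
- by have := s2 isT; have := s1' isT; lra.
- by have := s1 isT; have := s2' isT; lra.
Qed.
End Itineraries.

(** * Coding of binary words by shadowing orbits *)

Section Horseshoe.
Set Implicit Arguments.
Unset Strict Implicit.
Context {R : realType} {X : metricType R} {phi : R -> X -> X}.
Context (cX : compact [set: X]).
Context (flow : is_flow phi).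
Context (nosing : forall x, ~ singularity phi x).
Implicit Types (x y z : X) (s t u : R) (h : R -> R).

Local Notation d := (@mdist R X).

(** A large multiple of a period; the bound 1 makes it admissible as the duration of a leg. *)
Lemma periodic_long_period y (D : R) : Defs.periodic phi y ->
  exists D', [/\ 1 <= D', D <= D' & forall t, phi D' (phi t y) = phi t y].
Proof.
move=> [T [T0 Ty]]; pose M := Num.max 1 D.
have [M1 MD] : 1 <= M /\ D <= M by rewrite !le_max !lexx orbT.
pose k := (Num.truncn (M / T)).+1.
have kT : M <= k%:R * T by rewrite -ler_pdivrMr//; apply/ltW/truncnS_gt.
exists (k%:R * T); split; [lra|lra|move=> t].
have TE : phi T (phi t y) = phi t y by rewrite -(flowD flow) Ty.
by have := fixed_mul flow TE k; rewrite -pmulrn.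
Qed.

(** Lets [yA] be taken nearer to [p] than the whole orbit of [yB], hence off that orbit. *)
Lemma nonperiodic_dist_orbit p y : ~ Defs.periodic phi p -> Defs.periodic phi y ->
  exists2 r : R, 0 < r & forall z, Defs.orbit phi y z -> r <= d p z.
Proof.
move=> nper pery.
have cO := compact_closed (metric_hausdorff (T := X)) (periodic_orbit_compact flow pery).
have : nbhs p (~` Defs.orbit phi y).
  apply: open_nbhs_nbhs; split; first exact: closed_openC.
  move=> [s _ sp]; apply: nper; have [T [T0 Ty]] := pery.
  apply: (periodic_of_return flow T0).
  by rewrite -sp -(flowD flow) Ty.
case/nbhs_ballP => r /= r0 rO; exists r => // z Oz.
by rewrite leNgt; apply/negP => pz; apply: (rO z); rewrite ?ballEmdist.
Qed.

(** The order of choices matters: the accuracy [e], the orbits B and then A, the tolerance [L], the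
    short legs [Ds] with real-time bound [M0], and only then the long legs [Dl], which must outlast
    [M0 + 2 * L]. *)
Lemma exponentially_separated p : Omega phi p -> ~ Defs.periodic phi p ->
  shadowable phi p -> uniformly_expansive phi p ->
  exists e K : R, [/\ 0 < e, 0 < K & forall n : nat, exists E : seq X,
    Defs.separated phi (K * n.+1%:R) e E /\ size E = (2 ^ n)%N].
Proof.
move=> Op nper shp uep.
have [eF eF0 HF] := bounded_fellow_travel cX flow nosing uep.
have [eD eD0 [Hup Hlow]] := duration_bounds cX flow nosing.
pose e := Num.min eF eD.
have [e_F e_D] : e <= eF /\ e <= eD by rewrite !ge_min !lexx orbT.
have e0 : 0 < e by rewrite lt_min eF0 eD0.
have [delta [delta0 Hdelta]] := shp e e0.
have delta20 : 0 < delta / 2 by rewrite divr_gt0.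
have [e2 e20 He2] := flow_continuous_at flow 1 p delta20.
have [yB [perB yBp]] := closing cX flow nosing Op shp uep e20.
have [r r0 Hr] := nonperiodic_dist_orbit nper perB.
pose eta := Num.min (Num.min e2 eF) r.
have [eta2 etaF etar] : [/\ eta <= e2, eta <= eF & eta <= r].
  by rewrite !ge_min !lexx !orbT.
have eta0 : 0 < eta by rewrite !lt_min e20 eF0.
have [yA [perA yAp]] := closing cX flow nosing Op shp uep eta0.
have nAB : ~ Defs.orbit phi yB yA.
  by move=> /Hr; rewrite metric_sym; lra.
have [N HN] := HF yA yB perA perB ltac:(rewrite metric_sym; lra) nAB.
pose Y (c : bool) := if c then yA else yB.
have perY c : Defs.periodic phi (Y c) by case: c.
have Yp c : d (phi 1 p) (phi 1 (Y c)) < delta / 2.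
  by apply: He2; rewrite metric_sym; case: c => /=; lra.
have [M1 HM1] := Hup 1 ltr01.
(* [L] is at least the forbidden fellow-travel time [N] and the real-time bound [M1] for the initial
   unit leg. *)
pose L := Num.max (Num.max 1 N%:R) M1.
have [L1 LN LM1] : [/\ 1 <= L, N%:R <= L & M1 <= L].
  by rewrite !le_max !lexx !orbT.
have [D0 HD0] := Hlow (3 * L).
have [Ds HDs] := choice (fun c => periodic_long_period D0 (perY c)).
have [Ms HMs] := choice (fun c => Hup (Ds c) (ltac:(have [] := HDs c; lra))).
pose M0 := Num.max (Ms true) (Ms false).
have Ms0 c : Ms c <= M0 by case: c; rewrite /M0 le_max lexx ?orbT.
(* The extra 1 turns a weak bound into the strict one in [timed]. *)
have [D1 HD1] := Hlow (M0 + 2 * L + 1).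
have [Dl HDl] := choice (fun c => periodic_long_period (Num.max D0 D1) (perY c)).
have [Ml HMl] := choice (fun c => Hup (Dl c) (ltac:(have [] := HDl c; lra))).
pose M := Num.max (Num.max L M0) (Num.max (Ml true) (Ml false)).
clearbody L M0.
have [ML MM0] : L <= M /\ M0 <= M by rewrite !le_max !lexx !orbT.
have Mlc c : Ml c <= M by case: c; rewrite /M !le_max lexx !orbT.
pose D (c b : bool) := if b then Dl c else Ds c.
have D_ge1 c b : 1 <= D c b.
  by case: b; [have [] := HDl c|have [] := HDs c].
have D_ret c b : phi (D c b) (phi 1 (Y c)) = phi 1 (Y c).
  by case: b; [have [_ _ ->] := HDl c|have [_ _ ->] := HDs c].
have D_geD0 c b : D0 <= D c b.
  case: b; last by have [] := HDs c.
  by have [_ + _] := HDl c; rewrite ge_max => /andP[].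
pose timed (b : nat -> bool) (a : nat -> R) :=
    0 <= a 1%N <= L /\ forall i, (0 < i)%N ->
      [/\ 3 * L <= a i.+1 - a i, a i.+1 - a i <= M,
          ~~ b i -> a i.+1 - a i <= M0 & b i -> M0 + 2 * L < a i.+1 - a i].
(* The tuple holds a shadow, the inverse of its reparametrization, and the switching times in real
   and in pseudo-orbit time. *)
have itinerary (b : nat -> bool) :
    exists w : (X * (R -> R)) * ((nat -> R) * (nat -> R)),
    [/\ Rep w.1.2, timed b w.2.1 & forall i t, (0 < i)%N ->
      w.2.1 i <= t <= w.2.1 i.+1 ->
      d (phi t w.1.1) (phi (w.1.2 t - w.2.2 i) (phi 1 (Y (odd i)))) < e].
  (* Leg 0 follows [p] for time 1. The later ones alternate between A and B and close up at points
     within [delta / 2] of [phi 1 p], so every jump is below [delta]. *)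
  pose xs (i : int) := if i is Posz n.+1 then phi 1 (Y (odd n.+1)) else p.
  pose ts (i : int) := if i is Posz n.+1 then D (odd n.+1) (b n.+1) else 1.
  have [] := Hdelta (Some 0) None xs ts; first by [].
  - by [].
  - split => [[[|n]|n] _|[[|n]|n] [i0 _] _]//.
    + exact: D_ge1.
    + by have := Yp true; rewrite /xs /ts /=; lra.
    + rewrite -PoszD addn1 /xs /ts D_ret.
      have := Yp (odd n.+1); have := Yp (odd n.+2).
      set y1 := phi 1 (Y _); set y2 := phi 1 (Y (odd n.+1)).
      have := metric_triangle y2 (phi 1 p) y1.
      by rewrite [d y2 (phi 1 p)]metric_sym; lra.
  move=> x [h [Rh close]].
  have [g [Rg hg gh]] := Rep_inverse Rh.
  pose c n := sseq ts (Posz n).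
  have c0 : c 0%N = 0 by rewrite /c /= big_ord0.
  have cS n : c n.+1 = c n + ts (Posz n) by rewrite /c /= big_ord_recr.
  have closen n s : c n <= s <= c n + ts (Posz n) ->
      d (phi (s - c n) (xs (Posz n))) (phi (h s) x) < e.
    move=> sn; rewrite metric_sym; apply: close => //.
    by rewrite -PoszD addn1 -/(c n.+1) cS.
  have closeD n s : c n <= s <= c n + ts (Posz n) ->
      d (phi (s - c n) (xs (Posz n))) (phi (h s) x) < eD.
    by move=> /closen H; apply: lt_le_trans e_D.
  exists ((x, g), (h \o c, c)); split => //=.
    have h0 : h 0 = 0 by case: Rh.
    split.
      rewrite /comp cS c0; apply/andP; split.
        by rewrite -{1}h0; apply: (Rep_le Rh); rewrite add0r.
      have := HM1 p x h 0 Rh; rewrite h0 subr0 => H.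
      apply: le_trans LM1; apply: H => s; rewrite -c0; exact: (closeD 0%N).
    move=> [//|i] _; rewrite /comp cS.
    have low := HD0 _ _ _ _ _ (D_geD0 (odd i.+1) (b i.+1)) Rh (closeD i.+1).
    have short : ~~ b i.+1 -> h (c i.+1 + ts i.+1) - h (c i.+1) <= M0.
      move=> /negPf nb; apply: le_trans (Ms0 (odd i.+1)).
      have := closeD i.+1; rewrite /ts /D nb; exact: HMs.
    have long : b i.+1 -> h (c i.+1 + ts i.+1) - h (c i.+1) <= M.
      move=> nb; apply: le_trans (Mlc (odd i.+1)).
      have := closeD i.+1; rewrite /ts /D nb; exact: HMl.
    split => //.
    - by case: (boolP (b i.+1)) => // /short; lra.
    - move=> bi; have D1D : D1 <= D (odd i.+1) (b i.+1).
        by rewrite /D bi; have [_ + _] := HDl (odd i.+1); rewrite ge_max => /andP[].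
      have := HD1 _ _ _ _ _ D1D Rh (closeD i.+1); rewrite /ts; lra.
  move=> [//|i] t _ /andP[t1 t2]; rewrite metric_sym.
  have := closen i.+1 (g t); rewrite gh; apply.
  by rewrite -cS -{1}(hg (c i.+1)) -(hg (c i.+2)) !(Rep_le Rg).
have [w Hw] := choice itinerary.
(* The factor 2 ensures [n.+2 * M <= 2 * M * n.+1], the horizon needed to read [n] bits. *)
have K0 : 0 < 2 * M by lra.
exists e, (2 * M); split => // n.
(* Stays are numbered from 1, hence the predecessor; past the end of the word the bits are
   [false]. *)
pose bits (v : n.-tuple bool) (i : nat) := nth false v i.-1.
pose pt v := (w (bits v)).1.1.
have key (v v' : n.-tuple bool) :
    (forall u, 0 <= u <= 2 * M * n.+1%:R ->
      d (phi u (pt v)) (phi u (pt v')) < e) ->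
    v = v'.
  move=> near_vv'.
  have [Rg tv fv] := Hw (bits v); have [Rg' tv' fv'] := Hw (bits v').
  have same := switching_times_determine (L := L) (M0 := M0) (M := M)
    (T := 2 * M * n.+1%:R) (n := n) _ ML _ tv tv' _.
  apply: eq_from_tnth => i; rewrite !(tnth_nth false).
  apply: (same _ _ _ i.+1) => //; first lra.
    rewrite -[n.+2]addn1 natrD; have : 1 <= n.+1%:R :> R by rewrite ler1n.
    by nra.
  (* Opposite parities put one shadow near A and the other near B; the second case exchanges the two
     shadows. *)
  move=> j k u j0 k0; case Oj: (odd j); case Ok: (odd k) => // _ u1 u2 u3 u4 u5 u6.
    apply: (HN _ _ _ _ _ _ _ _ u Rg Rg' _ _ _).
    - by exists 1.
    - by exists 1.
    - move=> t tu; have fj := fv j t j0 ltac:(lra); have fk := fv' k t k0 ltac:(lra).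
      rewrite Oj in fj; rewrite Ok in fk.
      split; [exact: lt_le_trans fj e_F|exact: lt_le_trans fk e_F|].
      by apply: lt_le_trans e_F; apply: near_vv'; lra.
  apply: (HN _ _ _ _ _ _ _ _ u Rg' Rg _ _ _).
  - by exists 1.
  - by exists 1.
  - move=> t tu; have fj := fv j t j0 ltac:(lra); have fk := fv' k t k0 ltac:(lra).
    rewrite Oj in fj; rewrite Ok in fk.
    split; [exact: lt_le_trans fk e_F|exact: lt_le_trans fj e_F|].
    by rewrite metric_sym; apply: lt_le_trans e_F; apply: near_vv'; lra.
  exact: ltn_ord.
exists [seq pt v | v <- enum {: n.-tuple bool}]; split; last first.
  by rewrite size_map -cardE card_tuple card_bool.
split.
  (* Equal points stay at distance [0 < e], so [key] also gives injectivity. *)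
  rewrite map_inj_uniq ?enum_uniq// => v v' E; apply: key => u _.
  by rewrite E mdistxx.
move=> x y /mapP[v _ ->] /mapP[v' _ ->] vv'; apply: contrapT => no.
have [] := negP vv'; apply/eqP; congr pt; apply: key => u Hu.
by rewrite ltNge; apply/negP => Hd; apply: no; exists u.
Qed.
End Horseshoe.

(** * Positive entropy from exponential separation *)

Section Entropy.
Set Implicit Arguments.
Unset Strict Implicit.
Context {R : realType} {X : metricType R} {phi : R -> X -> X}.
Implicit Types (e t : R).

(** Singletons are separated; this keeps [s_sep] off [-oo] and in the range where [ln] is
    increasing. *)
Lemma s_sep_ge1 (p : X) t e : (1 <= s_sep phi t e)%E.
Proof.
apply: ereal_sup_ubound; exists [:: p] => //; split => // x y.
by rewrite !inE => /eqP-> /eqP->; rewrite eqxx.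
Qed.

Lemma s_sep_nonincreasing t e e' : e <= e' ->
  (s_sep phi t e' <= s_sep phi t e)%E.
Proof.
move=> ee'; apply: ereal_sup_le => _ [E [uE sE] <-]; exists E => //; split => //.
move=> x y xE yE xy; have [u [ut eu]] := sE x y xE yE xy.
by exists u; split => //; apply: le_trans eu.
Qed.

Lemma sep_rate_ge (r : R) t e : 0 < t -> 1 <= r -> (r%:E <= s_sep phi t e)%E ->
  ((ln r / t)%:E <= sep_rate phi e t)%E.
Proof.
move=> t0 r1; rewrite /sep_rate; case: (s_sep phi t e) => [s||//]; last by rewrite !leey.
rewrite !lee_fin => rs; rewrite ler_pM2r ?invr_gt0// ler_ln ?posrE//; lra.
Qed.

Lemma sep_rate_nonincreasing (p : X) t e e' : 0 < t -> e <= e' ->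
  (sep_rate phi e' t <= sep_rate phi e t)%E.
Proof.
move=> t0 /(s_sep_nonincreasing t); have := s_sep_ge1 p t e'.
rewrite {1}/sep_rate; case: (s_sep phi t e') => [r||] // r1 re.
  by apply: sep_rate_ge => //; rewrite -lee_fin.
by move: re; rewrite leye_eq => /eqP E; rewrite /sep_rate E.
Qed.

Lemma growth_nonincreasing (p : X) e e' : e <= e' ->
  (limf_esup (sep_rate phi e') (pinfty_nbhs R) <=
   limf_esup (sep_rate phi e) (pinfty_nbhs R))%E.
Proof.
move=> ee'; rewrite !limf_esupE; apply: le_ereal_inf_tmp => _ [V FV <-].
(* Restricting to positive times keeps division by [t] monotone. *)
apply: ge_ereal_inf; exists (ereal_sup (sep_rate phi e' @` (V `&` [set t | 0 < t]))).
  exists (V `&` [set t | 0 < t]) => //; apply: filterI => //.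
  exact: nbhs_pinfty_gt.
apply: ge_ereal_sup => _ [t [Vt t0] <-]; apply: le_ereal_sup_tmp.
by exists (sep_rate phi e t); [exists t|exact: sep_rate_nonincreasing].
Qed.

(** By monotonicity in the scale the limit at [0^'+] is a supremum, so the single scale [e]
    suffices. At time [K * n.+1] the rate is at least [n * ln 2 / (K * n.+1)], which is at least
    [ln 2 / (2 * K)] for [n >= 1]. *)
Lemma top_entropy_gt0 (p : X) (e K : R) : 0 < e -> 0 < K ->
  (forall n : nat, exists E : seq X,
    Defs.separated phi (K * n.+1%:R) e E /\ size E = (2 ^ n)%N) ->
  (0 < top_entropy phi)%E.
Proof.
move=> e0 K0 sepE.
pose f (e : R) := limf_esup (sep_rate phi e) (pinfty_nbhs R).
have fcvg : f x @[x --> 0^'+] --> ereal_sup (f @` [set` `]0, +oo[ ]).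
  apply: (nonincreasing_at_right_cvge +oo%O) => // x y _ _ xy.
  exact: (growth_nonincreasing p).
rewrite /top_entropy (cvg_lim (@ereal_hausdorff R) fcvg).
have ln2 : 0 < ln (2 : R) by rewrite ln_gt0// ltr1n.
have c0 : 0 < ln 2 / (2 * K) by rewrite divr_gt0// mulr_gt0.
apply: (@lt_le_trans _ _ (ln 2 / (2 * K))%:E); first by rewrite lte_fin.
apply: le_ereal_sup_tmp; exists (f e); first by exists e => //=; rewrite in_itv/= e0.
rewrite /f limf_esupE; apply: le_ereal_inf_tmp => _ [V [M [_ MV]] <-].
apply: le_ereal_sup_tmp.
(* The successor ensures [n >= 1], and the time [K * n.+1] exceeds [M], hence lies in [V]. *)
pose n := (Num.truncn (M / K)).+1.
have nM : M < K * n.+1%:R.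
  rewrite mulrC -ltr_pdivrMr//; apply: lt_le_trans (truncnS_gt _) _.
  by rewrite ler_nat.
have T0 : 0 < K * n.+1%:R by rewrite mulr_gt0.
exists (sep_rate phi e (K * n.+1%:R)); first by exists (K * n.+1%:R) => //; exact: MV.
have [E [sE szE]] := sepE n.
have : ((2 ^+ n)%:E <= s_sep phi (K * n.+1%:R) e)%E.
  by apply: ereal_sup_ubound; exists E => //; rewrite szE natrX.
move=> /(sep_rate_ge T0) H; apply: le_trans (H _); last by rewrite exprn_ege1// ler1n.
rewrite lee_fin lnXn// -[_ *+ n]mulr_natl ler_pdivrMr ?mulr_gt0//.
rewrite mulrAC ler_pdivlMr//.
have n1 : 1 <= n%:R :> R by rewrite ler1n.
have lnK : 0 <= ln (2 : R) * K by rewrite mulr_ge0// ltW.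
rewrite -[n.+1%:R]natr1.
have : 0 <= (ln 2 * K) * (n%:R - 1) by rewrite mulr_ge0// subr_ge0.
nra.
Qed.
End Entropy.

Theorem theoremB (R : realType) (X : metricType R) (phi : R -> X -> X) :
  compact [set: X] ->
  is_flow phi ->
  (forall x : X, ~ singularity phi x) ->
  (exists p : X, Omega phi p /\ ~ Per phi p /\
     shadowable phi p /\ uniformly_expansive phi p) ->
  (0 < top_entropy phi)%E.
Proof.
move=> cX flow nosing [p [Op [nper [shp uep]]]].
have [e [K [e0 K0 sepE]]] := exponentially_separated cX flow nosing Op nper shp uep.
exact: (top_entropy_gt0 p e0 K0 sepE).
Qed.
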